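(* Let $N_s,N_r,M_r,d$ be positive integers, let $\mathbf{F}\in\mathbb{C}^{N_s\times d}$, $\mathbf{G}\in\mathbb{C}^{N_r\times M_r}$, $\tilde{\mathbf{H}}_{sr}\in\mathbb{C}^{M_r\times N_s}$, $\tilde{\mathbf{H}}_{rr}\in\mathbb{C}^{M_r\times N_r}$, let $\mathbf{C}_{rx,sr},\mathbf{C}_{rx,rr}\in\mathbb{C}^{M_r\times M_r}$, $\mathbf{C}_{tx,sr}\in\mathbb{C}^{N_s\times N_s}$, $\mathbf{C}_{tx,rr}\in\mathbb{C}^{N_r\times N_r}$ be Hermitian positive semidefinite, and let $\kappa_s,\kappa_r,\beta_r,\sigma_{nr}^2$ be positive reals. Put $$\mathbf{M}_{in,0}=\tilde{\mathbf{H}}_{sr}\big(\mathbf{F}\mathbf{F}^H+\kappa_s\,\mathrm{diag}(\mathbf{F}\mathbf{F}^H)\big)\tilde{\mathbf{H}}_{sr}^H+\mathbf{C}_{rx,sr}\,\mathrm{tr}\Big(\mathbf{C}_{tx,sr}\big(\mathbf{F}\mathbf{F}^H+\kappa_s\,\mathrm{diag}(\mathbf{F}\mathbf{F}^H)\big)\Big)+\sigma_{nr}^2\mathbf{I}_{M_r}$$ and, for a Hermitian positive semidefinite matrix $\mathbf{M}\in\mathbb{C}^{N_r\times N_r}$, $$\mathcal{M}_1(\mathbf{F},\mathbf{M})=\mathbf{M}_{in,0}+\kappa_r\tilde{\mathbf{H}}_{rr}\,\mathrm{diag}(\mathbf{M})\,\tilde{\mathbf{H}}_{rr}^H+\mathbf{C}_{rx,rr}\,\mathrm{tr}\Big(\mathbf{C}_{tx,rr}\big(\mathbf{M}+\kappa_r\,\mathrm{diag}(\mathbf{M})\big)\Big)+\beta_r\,\mathrm{diag}\Big(\mathbf{M}_{in,0}+\tilde{\mathbf{H}}_{rr}\mathbf{M}\tilde{\mathbf{H}}_{rr}^H+\mathbf{C}_{rx,rr}\,\mathrm{tr}(\mathbf{C}_{tx,rr}\mathbf{M})\Big).$$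 Let $$\mathbf{B}=\kappa_r(\tilde{\mathbf{H}}_{rr}^*\otimes\tilde{\mathbf{H}}_{rr})\mathbf{D}_{N_r}+\beta_r\mathbf{D}_{M_r}(\tilde{\mathbf{H}}_{rr}^*\otimes\tilde{\mathbf{H}}_{rr})+\mathrm{vec}(\mathbf{C}_{rx,rr})\,\mathrm{vec}(\mathbf{C}_{tx,rr}^* )^T(\mathbf{I}_{N_r^2}+\kappa_r\mathbf{D}_{N_r})+\beta_r\mathbf{D}_{M_r}\mathrm{vec}(\mathbf{C}_{rx,rr})\,\mathrm{vec}(\mathbf{C}_{tx,rr}^* )^T,$$ and assume that $\mathbf{I}_{N_r^2}-(\mathbf{G}^*\otimes\mathbf{G})\mathbf{B}$ is invertible. Suppose that the Hermitian positive semidefinite matrix $\mathbf{M}_{out}\in\mathbb{C}^{N_r\times N_r}$ satisfies $\mathbf{M}_{out}=\mathbf{G}\,\mathcal{M}_1(\mathbf{F},\mathbf{M}_{out})\,\mathbf{G}^H$, and let $\mathbf{R}_{out}=\mathbf{M}_{out}+\kappa_r\,\mathrm{diag}(\mathbf{M}_{out})$. Then $$\mathrm{vec}(\mathbf{M}_{out})=\big(\mathbf{I}_{N_r^2}-(\mathbf{G}^*\otimes\mathbf{G})\mathbf{B}\big)^{-1}(\mathbf{G}^*\otimes\mathbf{G})(\mathbf{I}_{M_r^2}+\beta_r\mathbf{D}_{M_r})\,\mathrm{vec}(\mathbf{M}_{in,0})$$ and $$\mathrm{vec}(\mathbf{R}_{out})=(\mathbf{I}_{N_r^2}+\kappa_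r\mathbf{D}_{N_r})\big(\mathbf{I}_{N_r^2}-(\mathbf{G}^*\otimes\mathbf{G})\mathbf{B}\big)^{-1}(\mathbf{G}^*\otimes\mathbf{G})(\mathbf{I}_{M_r^2}+\beta_r\mathbf{D}_{M_r})\,\mathrm{vec}(\mathbf{M}_{in,0}).$$
   Context: Notation: $(\cdot)^*$ is the entrywise complex conjugate, $(\cdot)^T$ the transpose, $(\cdot)^H$ the conjugate transpose, $\otimes$ the Kronecker product, $\mathrm{tr}$ the trace, and $\mathbf{I}_K$ the $K\times K$ identity. For a square matrix $\mathbf{X}$, $\mathrm{diag}(\mathbf{X})$ is the diagonal matrix obtained from $\mathbf{X}$ by setting all off-diagonal entries to zero. $\mathrm{vec}(\mathbf{X})$ is the column vector obtained by stacking the columns of $\mathbf{X}$. For a positive integer $M$, $\mathbf{D}_M\in\{0,1\}^{M^2\times M^2}$ is the selection matrix with $\mathbf{D}_M\mathrm{vec}(\mathbf{X})=\mathrm{vec}(\mathrm{diag}(\mathbf{X}))$ for all $\mathbf{X}\in\mathbb{C}^{M\times M}$. Interpretation (not needed for the mathematics): a full-duplex amplify-and-forward relay with $N_r$ transmit and $M_r$ receive antennas and amplification matrix $\mathbf{G}$ receives from a source with $N_s$ antennas and precoder $\mathbf{F}$; $\tilde{\mathbf{H}}_{sr},\tilde{\mathbf{H}}_{rr}$ are the estimated source-relay and self-interference channels, the matrices $\mathbf{C}_{rx,\cdot},\mathbf{C}_{tx,\cdot}$ are the receive/transmit correlation matrices of the channel estimation errors, $\kappa_s,\kappa_r,\beta_r$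 are hardware distortion coefficients and $\sigma_{nr}^2$ is the relay noise variance. $\mathbf{M}_{out}$ is the undistorted relay transmit covariance, $\mathbf{R}_{out}$ is the distorted relay transmit covariance, and $\mathbf{M}_{in,0}$ is the undistorted received covariance at the relay when $\mathbf{G}=\mathbf{0}$. The fixed-point equation for $\mathbf{M}_{out}$ is the model relation obtained after neglecting products of distortion coefficients at the relay. *)

(* Defs.v *)
From mathcomp Require Export all_boot all_order all_algebra.
From mathcomp Require Export reals complex.
From mathcomp Require mxtens.

Set Implicit Arguments.
Unset Strict Implicit.
Unset Printing Implicit Defensive.

Import Order.TTheory GRing.Theory Num.Theory.
Local Open Scope ring_scope.
Local Open Scope sesquilinear_scope.

Declare Scope relay_scope.
Delimit Scope relay_scope with relay.

Notation "A *t B" := (mxtens.tensmx A B)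
  (at level 40, left associativity, format "A  *t  B") : relay_scope.

(* Entrywise conjugate; the conjugate transpose is the library's [A ^t*]. *)
Notation "A ^conj" := (map_mx Num.conj A)
  (at level 30, format "A ^conj") : relay_scope.

Local Open Scope relay_scope.

Definition psdmx (C : numClosedFieldType) (n : nat) (A : 'M[C]_n) : Prop :=
  A \is hermsymmx /\ (forall x : 'cV[C]_n, 0 <= (x ^t* *m A *m x) 0 0).

Definition diagpart (C : pzRingType) (n : nat) (X : 'M[C]_n) : 'M[C]_n :=
  \matrix_(i, j) (X i j *+ (i == j)).

(* Column stacking: X i j is entry j * m + i, the index convention that
   [tensmx] uses for the pair (j, i).  The library's [mxvec] stacks rows. *)
Definition vec (C : pzRingType) (m n : nat) (X : 'M[C]_(m, n)) : 'cV[C]_(n * m) :=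
  \col_k X (mxtens.mxtens_unindex k).2 (mxtens.mxtens_unindex k).1.

Definition selmx (C : pzRingType) (M : nat) : 'M[C]_(M * M) :=
  \matrix_(k, l) ((k == l) &&
    ((mxtens.mxtens_unindex k).1 == (mxtens.mxtens_unindex k).2))%:R.

Lemma vecE (C : pzRingType) (m n : nat) (X : 'M[C]_(m, n)) i j :
  vec X (mxtens.mxtens_index (j, i)) 0 = X i j.
Proof. by rewrite mxE mxtens.mxtens_indexK. Qed.

(* [selmx] is the unique matrix with the defining property of D_M. *)
Lemma selmx_vec (C : pzRingType) (M : nat) (X : 'M[C]_M) :
  selmx C M *m vec X = vec (diagpart X).
Proof.
apply/colP => k; rewrite !mxE (bigD1 k) //= big1 ?addr0 => [|l lk].
  by rewrite !mxE eqxx /= mulr_natl eq_sym.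
by rewrite !mxE eq_sym (negPf lk) mul0r.
Qed.

Lemma selmx_uniq (C : pzRingType) (M : nat) (D : 'M[C]_(M * M)) :
  (forall X : 'M[C]_M, D *m vec X = vec (diagpart X)) -> D = selmx C M.
Proof.
move=> hD; have eqD (X : 'M[C]_M) : D *m vec X = selmx C M *m vec X.
  by rewrite hD selmx_vec.
apply/matrixP => k l.
have vec_delta : vec (\matrix_(i, j) (mxtens.mxtens_index (j, i) == l)%:R)
    = delta_mx l 0 :> 'cV[C]_(M * M).
  apply/colP => h; rewrite !mxE andbT.
  by rewrite -surjective_pairing mxtens.mxtens_unindexK.
by have /colP/(_ k) := eqD (\matrix_(i, j) (mxtens.mxtens_index (j, i) == l)%:R);
  rewrite vec_delta -!colE !mxE.
Qed.

(* Main.v *)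
(** Column stacking turns [A X B] into [(B^T *t A) vec X], so [X |-> K X K^H]
   becomes [K^* *t K]; a trace [tr (P X)] with [P] Hermitian becomes the row
   vector [vec(P^* )^T] applied to [vec X]. Hence [vec (M1 M)] is the affine map
   [(1 + beta D) vec Min0 + B vec M], and the fixed-point equation is a linear
   system with matrix [A]. *)
Require Import Defs.
Import Order.TTheory GRing.Theory Num.Theory.
Local Open Scope complex_scope.
Local Open Scope ring_scope.
Local Open Scope sesquilinear_scope.
Local Open Scope relay_scope.

Section Vec.

Variable C : comPzRingType.

Lemma vecD m n (X Y : 'M[C]_(m, n)) : vec (X + Y) = vec X + vec Y.
Proof. by apply/colP => k; rewrite !mxE. Qed.

Lemma vecZ m n (a : C) (X : 'M[C]_(m, n)) : vec (a *: X) = a *: vec X.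
Proof. by apply/colP => k; rewrite !mxE. Qed.

(** Serves twice: for the distorted covariance inside the trace, and for the final passage from
    [Mout] to [Rout]. *)
Lemma vecD_diagpart n (a : C) (X : 'M[C]_n) :
  vec (X + a *: diagpart X) = (1%:M + a *: selmx C n) *m vec X.
Proof. by rewrite vecD vecZ mulmxDl mul1mx -scalemxAl selmx_vec. Qed.

Lemma sum_mxtens_index (m n : nat) (f : 'I_(m * n) -> C) :
  \sum_k f k = \sum_i \sum_j f (mxtens.mxtens_index (i, j)).
Proof.
rewrite pair_bigA /= (reindex (@mxtens.mxtens_index m n)) /=.
  by apply: eq_bigr => -[].
exists (@mxtens.mxtens_unindex m n) => k _.
  exact: mxtens.mxtens_indexK.
exact: mxtens.mxtens_unindexK.
Qed.

(** Splitting the summation index into a (column, row) pair of [X] turns the right side into the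
    double sum of the entry of [A *m X *m B], in the same order. Commutativity then moves the entry
    of [B] to the front. *)
Lemma vec_mulmx_mulmx m n p q (A : 'M[C]_(m, n)) (X : 'M[C]_(n, p))
    (B : 'M[C]_(p, q)) :
  vec (A *m X *m B) = (B^T *t A) *m vec X.
Proof.
apply/colP => k; rewrite !mxE sum_mxtens_index; apply: eq_bigr => j _.
rewrite mxE mulr_suml; apply: eq_bigr => i _.
by rewrite vecE !mxE mxtens.mxtens_indexK /= [LHS]mulrC mulrA.
Qed.

Lemma tr_vec_mul m n (X Y : 'M[C]_(m, n)) :
  (vec X)^T *m vec Y = (\tr (X^T *m Y))%:M.
Proof.
apply/matrixP => a b; rewrite !ord1 !mxE eqxx mulr1n sum_mxtens_index.
apply: eq_bigr => j _; rewrite mxE; apply: eq_bigr => i _.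
by rewrite vecE !mxE mxtens.mxtens_indexK.
Qed.

End Vec.

Section ConjVec.

Variable C : numClosedFieldType.

Lemma conj_tr_hermsymmx n (A : 'M[C]_n) : A \is hermsymmx -> (A ^conj)^T = A.
Proof.
by move/is_hermitianmxP; rewrite expr0 scale1r => {2}->; rewrite map_trmx.
Qed.

Lemma vec_conjugation m n (K : 'M[C]_(m, n)) (X : 'M[C]_n) :
  vec (K *m X *m K ^t*) = (K ^conj *t K) *m vec X.
Proof. by rewrite vec_mulmx_mulmx map_trmx trmxK. Qed.

(** The pairing in [tr_vec_mul] is bilinear and transposes its first argument; conjugating [P]
    compensates, since [P] is Hermitian. The trace becomes a 1 x 1 matrix, so scaling [Q] is right
    multiplication of the column [vec Q]. *)
Lemma vec_scale_trace m n (Q : 'M[C]_m) (P X : 'M[C]_n) :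
  P \is hermsymmx ->
  vec (\tr (P *m X) *: Q) = vec Q *m ((vec (P ^conj))^T *m vec X).
Proof.
by move=> hP; rewrite vecZ tr_vec_mul conj_tr_hermsymmx ?mul_mx_scalar.
Qed.

Lemma vec_received_covariance m n (k b : C) (M0 Q : 'M[C]_m) (P M : 'M[C]_n)
    (H : 'M[C]_(m, n)) : P \is hermsymmx ->
  vec (M0 + k *: (H *m diagpart M *m H ^t*)
       + \tr (P *m (M + k *: diagpart M)) *: Q
       + b *: diagpart (M0 + H *m M *m H ^t* + \tr (P *m M) *: Q))
  = (1%:M + b *: selmx C m) *m vec M0
    + (k *: ((H ^conj *t H) *m selmx C n)
       + b *: (selmx C m *m (H ^conj *t H))
       + vec Q *m (vec (P ^conj))^T *m (1%:M + k *: selmx C n)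
       + b *: (selmx C m *m vec Q *m (vec (P ^conj))^T)) *m vec M.
Proof.
move=> hP; rewrite 3!vecD (vecZ _ _ _ k) (vecZ _ _ _ b) -selmx_vec
  2!vecD !vec_conjugation.
rewrite !vec_scale_trace // vecD_diagpart -selmx_vec.
rewrite 4![in RHS]mulmxDl mul1mx -!scalemxAl 2!mulmxDr !mulmxA 2!scalerDr.
(* Terms 1 and 4 carry [vec M0], directly and through the receive distortion; 2, 5, 3, 6 match the
   four summands of the coefficient of [vec M]. *)
by rewrite [LHS](AC (3*3) ((1*4)*(2*5*3*6))).
Qed.

End ConjVec.

Theorem mainTheorem1 (R : realType) (Ns Nr Mr d : nat)
  (Ns_gt0 : (0 < Ns)%N) (Nr_gt0 : (0 < Nr)%N)
  (Mr_gt0 : (0 < Mr)%N) (d_gt0 : (0 < d)%N)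
  (F : 'M[R[i]]_(Ns, d)) (G : 'M[R[i]]_(Nr, Mr))
  (Hsr : 'M[R[i]]_(Mr, Ns)) (Hrr : 'M[R[i]]_(Mr, Nr))
  (Crxsr Crxrr : 'M[R[i]]_Mr) (Ctxsr : 'M[R[i]]_Ns) (Ctxrr : 'M[R[i]]_Nr)
  (Crxsr_psd : psdmx Crxsr) (Crxrr_psd : psdmx Crxrr)
  (Ctxsr_psd : psdmx Ctxsr) (Ctxrr_psd : psdmx Ctxrr)
  (kappas kappar betar sigmanr2 : R)
  (kappas_gt0 : 0 < kappas) (kappar_gt0 : 0 < kappar)
  (betar_gt0 : 0 < betar) (sigmanr2_gt0 : 0 < sigmanr2) :
  let Min0 : 'M[R[i]]_Mr :=
    Hsr *m (F *m F ^t* + kappas%:C *: diagpart (F *m F ^t*)) *m Hsr ^t*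
    + \tr (Ctxsr *m (F *m F ^t* + kappas%:C *: diagpart (F *m F ^t*))) *: Crxsr
    + sigmanr2%:C *: 1%:M in
  let M1 (M : 'M[R[i]]_Nr) : 'M[R[i]]_Mr :=
    Min0
    + kappar%:C *: (Hrr *m diagpart M *m Hrr ^t*)
    + \tr (Ctxrr *m (M + kappar%:C *: diagpart M)) *: Crxrr
    + betar%:C *: diagpart (Min0 + Hrr *m M *m Hrr ^t*
                            + \tr (Ctxrr *m M) *: Crxrr) in
  let B : 'M[R[i]]_(Mr * Mr, Nr * Nr) :=
    kappar%:C *: ((Hrr ^conj *t Hrr) *m selmx R[i] Nr)
    + betar%:C *: (selmx R[i] Mr *m (Hrr ^conj *t Hrr))
    + vec Crxrr *m (vec (Ctxrr ^conj))^T *m (1%:M + kappar%:C *: selmx R[i] Nr)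
    + betar%:C *: (selmx R[i] Mr *m vec Crxrr *m (vec (Ctxrr ^conj))^T) in
  let A : 'M[R[i]]_(Nr * Nr) := 1%:M - (G ^conj *t G) *m B in
  A \in unitmx ->
  forall Mout : 'M[R[i]]_Nr,
  psdmx Mout ->
  Mout = G *m M1 Mout *m G ^t* ->
  let Rout : 'M[R[i]]_Nr := Mout + kappar%:C *: diagpart Mout in
  vec Mout =
    invmx A *m (G ^conj *t G) *m (1%:M + betar%:C *: selmx R[i] Mr) *m vec Min0
  /\
  vec Rout =
    (1%:M + kappar%:C *: selmx R[i] Nr) *m invmx A *m (G ^conj *t G)
      *m (1%:M + betar%:C *: selmx R[i] Mr) *m vec Min0.
Proof.
move=> Min0 M1 B A A_unit Mout _ Mout_fix Rout.
have vecMout : vec Mout = invmx A *m (G ^conj *t G)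
    *m (1%:M + betar%:C *: selmx R[i] Mr) *m vec Min0.
  have vecM1 : vec (M1 Mout)
      = (1%:M + betar%:C *: selmx R[i] Mr) *m vec Min0 + B *m vec Mout.
    by apply: vec_received_covariance; case: Ctxrr_psd.
  (* Left multiplication by the unit [A] is injective, and it removes the inverse. *)
  apply: (can_inj (mulKmx A_unit)); rewrite !mulmxA mulmxV // mul1mx.
  (* The fixed-point equation replaces only the [Mout] coming from the identity in [A]; the [B] term
     it produces cancels against the other one. *)
  rewrite /A mulmxBl mul1mx {1}Mout_fix vec_conjugation vecM1 mulmxDr !mulmxA.
  by rewrite addrK.
split; first exact: vecMout.
(* Only bracketing remains, an identity valid for any matrix in place of [invmx A], which is
   therefore made opaque. *)
by rewrite vecD_diagpart vecMout; move: (invmx A) => iA; rewrite !mulmxA.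
Qed.
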